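(* Let $G$ be a graph with $n$ vertices, $m>0$ edges and chromatic number $\chi$. Then, for any $\alpha\in[0,1]$, $$\lambda_n(B_\alpha(G))\le\frac{2m}{n}\left(\frac{\chi(1-\alpha)-\alpha}{\chi-1}\right).$$
   Context: All graphs are simple and undirected, with a finite vertex set. $A(G)$ is the adjacency matrix, $D(G)$ the diagonal matrix of vertex degrees, and $L(G)=D(G)-A(G)$ the Laplacian matrix of $G$. For $\alpha\in[0,1]$, $B_\alpha(G):=\alpha A(G)+(1-\alpha)L(G)$. The eigenvalues of a real symmetric $n\times n$ matrix $S$ are ordered $\lambda_1(S)\ge\cdots\ge\lambda_n(S)$, so $\lambda_n$ is the smallest eigenvalue. *)

(* Defs.v *)
From mathcomp Require Import all_boot all_order all_algebra.
From mathcomp Require Import polyrcf.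

Set Implicit Arguments.
Unset Strict Implicit.
Unset Printing Implicit Defensive.

Import Order.TTheory GRing.Theory Num.Theory.
Local Open Scope ring_scope.

Record sgraph := SGraph {
  vertex :> finType;
  adj : rel vertex;
  adj_sym : symmetric adj;
  adj_irr : irreflexive adj }.

Section Graph.
Variable G : sgraph.

Definition edges : {set {set G}} :=
  [set E | [exists x, [exists y, adj x y && (E == [set x; y])]]].

Definition deg (x : G) : nat := #|[set y | adj x y]|.

Definition colorable (k : nat) : bool :=
  [exists f : {ffun G -> 'I_k}, [forall x, forall y, adj x y ==> (f x != f y)]].

Lemma colorable_ex : exists k, colorable k.
Proof.
exists #|G|; apply/existsP; exists [ffun x => enum_rank x].
apply/forallP => x; apply/forallP => y; apply/implyP => xy; rewrite !ffunE.
by apply: contraTneq xy => /enum_rank_inj->; rewrite adj_irr.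
Qed.

Definition chromatic_number : nat := ex_minn colorable_ex.

Variable R : nzRingType.

(* Rows and columns are indexed by the vertices through [enum_val]. *)
Definition adjacency_mx : 'M[R]_#|G| :=
  \matrix_(i, j) (adj (enum_val i) (enum_val j))%:R.

Definition degree_mx : 'M[R]_#|G| :=
  diag_mx (\row_i (deg (enum_val i))%:R).

Definition laplacian_mx : 'M[R]_#|G| := degree_mx - adjacency_mx.

Definition B_mx (alpha : R) : 'M[R]_#|G| :=
  alpha *: adjacency_mx + (1 - alpha) *: laplacian_mx.

End Graph.

Section Eigenvalues.
Variables (R : rcfType) (n : nat).

(* The roots in [R] of the characteristic polynomial, repeated according to
   multiplicity, in nonincreasing order; this has exactly [n] entries when [S]
   is symmetric. *)
Definition eigenvalues (S : 'M[R]_n) : seq R :=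
  let p := char_poly S in
  sort >=%R (flatten [seq nseq (mup x p) x | x <- rootsR p]).

(* The index [k] is 1-based: [lambda 1 S] is the largest eigenvalue of a
   symmetric [S] and [lambda n S] the smallest. *)
Definition lambda (k : nat) (S : 'M[R]_n) : R := (eigenvalues S)`_k.-1.

End Eigenvalues.

(* Main.v *)
Require Import Defs.
From mathcomp Require Import all_boot all_order all_algebra.
From mathcomp Require Import polyrcf complex ring.

Import Order.TTheory GRing.Theory Num.Theory.
Local Open Scope ring_scope.
Local Open Scope sesquilinear_scope.

(** Write [B] for [B_mx G alpha] and let [f] be a proper colouring of [G] with
    [k = chromatic_number G] colours.  Give the vertex [x] the vector
    [e_(f x) - (1/k) (e_1 + ... + e_k)], that is, place the vertices at the
    corners of a regular simplex centred at the origin.  Two such vectors have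
    inner product [1 - 1/k] if the colours agree and [- 1/k] if they differ.
    Since adjacent vertices have different colours, the off-diagonal part of
    [B], which is [(2 alpha - 1) A], only meets the value [- 1/k], and its
    diagonal part, which is [(1 - alpha) D], only meets [1 - 1/k].  As both [A]
    and [D] have entries summing to [2m], the quadratic form of [B], added up
    over the [k] coordinates, is exactly
      [2m ((1 - alpha) (1 - 1/k) - (2 alpha - 1) / k)],
    while the squared norms add up to [n (1 - 1/k)].  The smallest eigenvalue is
    at most the quotient of these two numbers, which is the bound
    ([trace_simplex_B], [trace_simplex]).

    What remains is the Rayleigh principle for symmetric matrices over a real
    closed field [R], for an eigenvalue list read off from the roots in [R] of
    the characteristic polynomial ([lambda_min_trace]).  Over [R[i]] a symmetric
    real matrix is unitarily diagonalizable with a real diagonal, so its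
    characteristic polynomial already splits over [R]; hence the list is a
    permutation of that diagonal and its last entry is the least one.  In the
    diagonalizing coordinates the Rayleigh inequality holds term by term. *)

Lemma mup_prod_XsubC (F : fieldType) (x : F) (s : seq F) :
  mup x (\prod_(a <- s) ('X - a%:P)) = count_mem x s.
Proof.
elim: s => [|a s IHs] /=; first by rewrite big_nil mupNroot // root1.
rewrite big_cons mupM ?polyXsubC_eq0 ?monic_neq0 ?monic_prod_XsubC // IHs.
by have := mup_XsubCX 1 x a; rewrite expr1 => ->; case: eqVneq.
Qed.

Lemma perm_eigenvalues {R : rcfType} {n} (S : 'M[R]_n) (s : seq R) :
  char_poly S = \prod_(a <- s) ('X - a%:P) -> perm_eq (eigenvalues S) s.
Proof.
move=> charS; rewrite /eigenvalues perm_sort; apply/allP => x _ /=.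
rewrite -[X in _ == X]mup_prod_XsubC -charS.
have p_neq0 : char_poly S != 0 by rewrite monic_neq0 // char_poly_monic.
rewrite count_flatten sumnE !big_map.
have rootsP : (x \in rootsR (char_poly S)) = root (char_poly S) x.
  by have := roots_on_rootsR p_neq0 x; rewrite inE /= => ->.
case: (boolP (x \in rootsR (char_poly S))) => xP.
  rewrite (bigD1_seq x) ?uniq_roots //= count_nseq /= eqxx mul1n big1 ?addn0 //.
  by move=> y /negPf yx; rewrite count_nseq /= yx.
rewrite mupNroot -?rootsP // big1_seq // => y /= yP.
by rewrite count_nseq /= (negPf (memPn xP y yP)).
Qed.

(** The splitting hypothesis is what makes [n] a meaningful index: it forces the
    eigenvalue list to have [n] entries, so that entry [n.-1] is the last one and
    not the default value [0]. *)
Lemma lambda_min_le {R : rcfType} {n} (S : 'M[R]_n) (s : seq R) :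
  char_poly S = \prod_(a <- s) ('X - a%:P) ->
  forall a, a \in s -> lambda n S <= a.
Proof.
move=> charS a; have perm_s := perm_eigenvalues _ _ charS.
have size_s : size (eigenvalues S) = n.
  rewrite (perm_size perm_s); apply: succn_inj.
  by rewrite -(size_char_poly S) charS size_prod_XsubC.
rewrite -(perm_mem perm_s) => /(nthP 0) => -[k]; rewrite size_s => lt_kn <-.
(* In a nonincreasing list every entry is at least the last one. *)
apply: (@sorted_leq_nth _ >=%R) => //; rewrite ?inE ?size_s ?prednK //.
- by move=> x y z /= yx xz; apply: le_trans yx.
- by move=> x /=.
- by apply: sort_sorted => x y; apply: le_total.
- exact: leq_trans lt_kn.
- by rewrite -ltnS prednK // (leq_trans _ lt_kn).
Qed.

(** The unitary matrix comes from the spectral theorem over the algebraically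
    closed field [R[i]]; only the diagonal is known to be real, because the
    eigenvalues of a Hermitian matrix are. *)
Lemma symmetric_diagonalization {R : rcfType} {n} (S : 'M[R]_n) : S^T = S ->
  exists (P : 'M[R[i]]_n) (r : 'rV[R]_n), P \is unitarymx /\
    map_mx (real_complex R) S
      = P ^t* *m diag_mx (map_mx (real_complex R) r) *m P.
Proof.
move=> symS; pose Sc := map_mx (real_complex R) S.
have Sc_herm : Sc \is hermsymmx.
  apply: realsym_hermsym.
    by apply/is_hermitianmxP; rewrite expr0 scale1r map_mx_id // map_trmx symS.
  by apply/mxOverP => i j; rewrite mxE complex_real.
have /orthomx_spectralP Sc_eq := hermitian_normalmx Sc_herm.
have /mxOverP d_real := hermitian_spectral_diag_real Sc_herm.
exists (spectralmx Sc), (\row_i complex.Re (spectral_diag Sc 0 i)).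
split; first exact: spectral_unitarymx.
rewrite -invmx_unitary ?spectral_unitarymx // [LHS]Sc_eq.
congr (_ *m diag_mx _ *m _); apply/rowP => i; rewrite !mxE.
by rewrite RRe_real.
Qed.

Lemma char_poly_similar (F : fieldType) n (P A : 'M[F]_n) :
  P \in unitmx -> char_poly (invmx P *m A *m P) = char_poly A.
Proof.
move=> unitP; pose c := map_mx (@polyC F).
have PVP : c _ _ (invmx P) *m c _ _ P = 1%:M.
  by rewrite -map_mxM mulVmx // map_mx1.
have -> : char_poly (invmx P *m A *m P)
    = \det (c _ _ (invmx P) *m char_poly_mx A *m c _ _ P).
  congr (\det _); rewrite /char_poly_mx mulmxBr mulmxBl !map_mxM /= -/c.
  by rewrite mul_mx_scalar -scalemxAl PVP scalemx1.
by rewrite !det_mulmx mulrAC -det_mulmx PVP det1 mul1r.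
Qed.

Lemma char_poly_diagonalized {R : rcfType} {n} (S : 'M[R]_n)
    (P : 'M[R[i]]_n) (r : 'rV[R]_n) : P \is unitarymx ->
  map_mx (real_complex R) S
    = P ^t* *m diag_mx (map_mx (real_complex R) r) *m P ->
  char_poly S = \prod_(a <- codom (r 0)) ('X - a%:P).
Proof.
move=> unitP Sc_eq; apply: (map_poly_inj (real_complex R)).
rewrite map_char_poly Sc_eq.
rewrite -invmx_unitary // char_poly_similar ?unitarymx_unit //.
rewrite char_poly_trig ?diag_mx_is_trig // rmorph_prod codomE big_map enumT.
by apply: eq_bigr => i _; rewrite !mxE eqxx mulr1n rmorphB /= map_polyX map_polyC.
Qed.

(** The Rayleigh principle for all the rows of [X] at once.  With
    [Y = X P^*] the two traces become [\sum r_j |Y_ij|^2] and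
    [\sum |Y_ij|^2], and every [r_j] is at least the last eigenvalue. *)
Lemma lambda_min_trace {R : rcfType} {n k} (S : 'M[R]_n) (X : 'M[R]_(k, n)) :
  S^T = S -> lambda n S * \tr (X *m X^T) <= \tr (X *m S *m X^T).
Proof.
move=> symS; have [P [r [unitP Sc_eq]]] := symmetric_diagonalization _ symS.
have min_r i : lambda n S <= r 0 i.
  apply: lambda_min_le _ _ (char_poly_diagonalized _ _ _ unitP Sc_eq) _ _.
  exact: codom_f.
pose c := map_mx (real_complex R); pose Y := c _ _ X *m P ^t*.
have cXT : c _ _ X^T = (c _ _ X) ^t*.
  by apply/matrixP => i j; rewrite !mxE; apply/esym/conj_Creal/complex_realP; exists (X j i).
have YT : Y ^t* = P *m c _ _ X^T.
  by rewrite /Y trmx_mul map_mxM -cXT trmxCK.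
have trD (d : 'rV[R]_n) : \tr (Y *m diag_mx (c _ _ d) *m Y ^t*)
    = \sum_i \sum_j (d 0 j)%:C%C * (`|Y i j| ^+ 2).
  apply: eq_bigr => i _; rewrite !mxE; apply: eq_bigr => j _.
  by rewrite mul_mx_diag !mxE normCK; ring.
have trS : (\tr (X *m S *m X^T))%:C%C
    = \sum_i \sum_j (r 0 j)%:C%C * (`|Y i j| ^+ 2).
  by rewrite -trD -trace_map_mx !map_mxM /= -/c Sc_eq YT /Y !mulmxA.
have trX : (\tr (X *m X^T))%:C%C = \sum_i \sum_j (`|Y i j| ^+ 2).
  rewrite -trace_map_mx map_mxM -/c.
  have -> : c _ _ X *m c _ _ X^T = Y *m Y ^t*.
    by rewrite YT /Y mulmxA mulmxKtV.
  by apply: eq_bigr => i _; rewrite !mxE; apply: eq_bigr => j _; rewrite !mxE normCK.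
rewrite -lecR rmorphM /= trS trX mulr_sumr ler_sum // => i _.
rewrite mulr_sumr ler_sum // => j _.
by rewrite ler_wpM2r ?exprn_ge0 // lecR.
Qed.

(** Each edge [{x, y}] is the image of exactly the two ordered pairs [(x, y)]
    and [(y, x)], which differ because adjacency is irreflexive. *)
Lemma handshake (G : sgraph) :
  (\sum_(x : G) \sum_(y : G) adj x y = 2 * #|edges G|)%N.
Proof.
rewrite pair_big /=.
have -> : (\sum_(p : G * G) adj p.1 p.2 = \sum_(p : G * G | adj p.1 p.2) 1)%N.
  by rewrite [RHS]big_mkcond; apply: eq_bigr => p _; case: adj.
rewrite (partition_big (fun p : G * G => [set p.1; p.2]) (mem (edges G))) /=; last first.
  by move=> [x y] /= xy; rewrite inE; apply/existsP; exists x; apply/existsP; exists y; rewrite xy eqxx.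
rewrite mulnC -sum_nat_const; apply: eq_bigr => E.
rewrite inE => /existsP[x /existsP[y /andP[xy /eqP->]]].
have neq_xy : x != y by apply: contraTneq xy => ->; rewrite adj_irr.
rewrite sum1_card (@eq_card _ _ (mem [set (x, y); (y, x)])) ?cards2; last first.
  move=> [u v]; rewrite !inE /= /in_mem /= !xpair_eqE.
  apply/andP/orP => [[uv /eqP/setP Euv]|].
    have neq_uv : u != v by apply: contraTneq uv => ->; rewrite adj_irr.
    have := Euv u; have := Euv v; rewrite !inE !eqxx orbT.
    move=> /esym/pred2P v_xy /esym/pred2P u_xy.
    by case: u_xy neq_uv => ->; case: v_xy => ->; rewrite ?eqxx //; auto.
  case=> /andP[/eqP-> /eqP->]; first by rewrite xy eqxx.
  by rewrite adj_sym xy setUC eqxx.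
by rewrite xpair_eqE (negPf neq_xy).
Qed.

Lemma chromatic_number_gt1 (G : sgraph) :
  (0 < #|edges G|)%N -> (1 < chromatic_number G)%N.
Proof.
case/card_gt0P => E; rewrite inE => /existsP[x /existsP[y /andP[xy _]]].
rewrite /chromatic_number; case: ex_minnP => k /existsP[f /forallP/(_ x)].
move=> /forallP/(_ y)/implyP/(_ xy) + _.
case: k f => [|[|k]] f //; first by case: (f x).
by rewrite !ord1.
Qed.

Lemma B_mx_sym (R : rcfType) (G : sgraph) (alpha : R) :
  (B_mx G alpha)^T = B_mx G alpha.
Proof.
apply/matrixP => i j; rewrite !mxE adj_sym.
by case: (eqVneq j i) => [->|].
Qed.

Lemma chromatic_coloring (G : sgraph) :
  exists f : {ffun G -> 'I_(chromatic_number G)},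
    forall x y, adj x y -> f x != f y.
Proof.
rewrite /chromatic_number; case: ex_minnP => k /existsP => -[f f_proper] _.
exists f => x y; apply/implyP.
by have /forallP/(_ x)/forallP/(_ y) := f_proper.
Qed.

Lemma sum_enum_val (T : finType) (V : nmodType) (F : T -> V) :
  \sum_(i < #|T|) F (enum_val i) = \sum_x F x.
Proof. by rewrite [RHS](reindex _ (onW_bij _ (@enum_val_bij T))). Qed.

Lemma degE (R : nzRingType) (G : sgraph) (x : G) :
  (deg x)%:R = \sum_(j < #|G|) (adj x (enum_val j))%:R :> R.
Proof.
rewrite (sum_enum_val _ _ (fun y : G => (adj x y)%:R)).
rewrite /deg -sum1_card natr_sum big_mkcond.
by apply: eq_bigr => y _; rewrite inE; case: adj.
Qed.

Lemma sum_adj (R : nzRingType) (G : sgraph) :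
  \sum_(i < #|G|) \sum_(j < #|G|) (adj (enum_val i) (enum_val j))%:R
    = 2 * #|edges G|%:R :> R.
Proof.
rewrite -natrM -handshake natr_sum -[RHS]sum_enum_val.
by apply: eq_bigr => i _; rewrite natr_sum -[RHS]sum_enum_val.
Qed.

(** Column [i] is the corner, indexed by the colour of vertex [i], of a regular
    simplex centred at the origin in dimension [k].  The corners are left
    unnormalized so that no square root is needed. *)
Definition simplex_mx (R : fieldType) (G : sgraph) (k : nat)
    (f : {ffun G -> 'I_k}) : 'M[R]_(k, #|G|) :=
  \matrix_(a, i) ((f (enum_val i) == a)%:R - k%:R^-1).
Arguments simplex_mx R {G k} f.

Section Simplex.
Variables (R : numFieldType) (G : sgraph) (k : nat) (f : {ffun G -> 'I_k}).
Hypothesis k_gt0 : (0 < k)%N.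

Lemma simplex_gram (i j : 'I_#|G|) :
  \sum_a simplex_mx R f a i * simplex_mx R f a j
    = (f (enum_val i) == f (enum_val j))%:R - k%:R^-1.
Proof.
have k_neq0 : k%:R != 0 :> R by rewrite pnatr_eq0 -lt0n.
have delta (b : 'I_k) (F : 'I_k -> R) : \sum_a (b == a)%:R * F a = F b.
  rewrite (bigD1 b) //= eqxx mul1r big1 ?addr0 // => a.
  by rewrite eq_sym => /negPf->; rewrite mul0r.
have delta1 (b : 'I_k) : \sum_a (b == a)%:R = 1 :> R.
  by rewrite -[RHS](delta b (fun=> 1)); apply: eq_bigr => a _; rewrite mulr1.
under eq_bigr => a _ do rewrite !mxE mulrBl.
rewrite sumrB delta -mulr_sumr sumrB delta1 sumr_const card_ord.
rewrite -[k%:R^-1 *+ k]mulr_natr mulVf // subrr mulr0 subr0.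
by rewrite [in LHS]eq_sym.
Qed.

Lemma trace_simplex :
  \tr (simplex_mx R f *m (simplex_mx R f)^T) = #|G|%:R * (1 - k%:R^-1).
Proof.
rewrite mxtrace_mulC.
transitivity (\sum_(i < #|G|) (1 - k%:R^-1) : R); last first.
  by rewrite sumr_const card_ord mulr_natl.
apply: eq_bigr => i _; rewrite mxE.
under eq_bigr => a _ do rewrite [_^T _ _]mxE.
by rewrite simplex_gram eqxx.
Qed.

(** Properness of [f] enters entrywise: at adjacent vertices the Gram matrix of
    the simplex vectors is always [- 1/k], so that [B] only sees its own diagonal
    sum and its own off-diagonal sum, each determined by the edge count. *)
Lemma trace_simplex_B (alpha : R) : (forall x y, adj x y -> f x != f y) ->
  \tr (simplex_mx R f *m B_mx G alpha *m (simplex_mx R f)^T)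
    = 2 * #|edges G|%:R
      * ((1 - alpha) * (1 - k%:R^-1) - (2 * alpha - 1) * k%:R^-1).
Proof.
move=> f_proper; rewrite -mulmxA mxtrace_mulC -mulmxA.
set c := (1 - alpha) * _; set d := _ * k%:R^-1.
transitivity (\sum_(i < #|G|) \sum_(j < #|G|)
    (c - d) * (adj (enum_val i) (enum_val j))%:R : R); last first.
  under eq_bigr => i _ do rewrite -mulr_sumr.
  by rewrite -mulr_sumr sum_adj mulrC.
apply: eq_bigr => i _; rewrite mxE.
transitivity (\sum_(j < #|G|) (c * ((i == j)%:R * (deg (enum_val i))%:R)
    - d * (adj (enum_val i) (enum_val j))%:R) : R).
  apply: eq_bigr => j _; rewrite [(_^T *m _) j i]mxE /c /d.
  under eq_bigr => a _ do rewrite [_^T _ _]mxE.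
  rewrite simplex_gram !mxE.
  case: eqVneq => [<-|neq_ij]; first by rewrite adj_irr eqxx /= mulr1n; ring.
  case: (boolP (adj _ _)) => [/f_proper/negPf|_]; last by rewrite /=; ring.
  by rewrite eq_sym => ->; rewrite /=; ring.
rewrite sumrB -!mulr_sumr (bigD1 i) //= eqxx mul1r big1 ?addr0; last first.
  by move=> j; rewrite eq_sym => /negPf->; rewrite mul0r.
by rewrite degE mulrBl.
Qed.

End Simplex.

Theorem theorem4p6 (R : rcfType) (G : sgraph) (n m chi : nat) (alpha : R)
    (hn : #|G| = n) (hm : #|edges G| = m) (m_gt0 : (0 < m)%N)
    (hchi : chromatic_number G = chi) (halpha : 0 <= alpha <= 1) :
  lambda n (B_mx G alpha) <=
    (2 * m%:R / n%:R) * ((chi%:R * (1 - alpha) - alpha) / (chi%:R - 1)).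
Proof.
rewrite -{n}hn -hm -{chi}hchi; rewrite -hm in m_gt0.
have [f f_proper] := chromatic_coloring G.
have chi_gt1 := chromatic_number_gt1 G m_gt0.
move: (chromatic_number G) chi_gt1 f f_proper => chi chi_gt1 f f_proper.
have chi_gt0 : (0 < chi)%N by apply: ltnW.
have n_gt0 : (0 < #|G|)%N.
  move: m_gt0 => /card_gt0P => -[E].
  by rewrite inE => /existsP => -[x _]; apply/card_gt0P; exists x.
have chi_neq0 : chi%:R != 0 :> R by rewrite pnatr_eq0 -lt0n.
have chi1_gt0 : 0 < chi%:R - 1 :> R by rewrite subr_gt0 ltr1n.
have nR_gt0 : 0 < #|G|%:R :> R by rewrite ltr0n.
have := lambda_min_trace _ (simplex_mx R f) (B_mx_sym R G alpha).
rewrite trace_simplex // trace_simplex_B // -ler_pdivlMr; last first.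
  by rewrite mulr_gt0 // subr_gt0 invf_lt1 ?ltr1n // ltr0n.
congr (_ <= _); field.
by rewrite (gt_eqF chi1_gt0) (gt_eqF nR_gt0) chi_neq0.
Qed.
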